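(* Let $\alpha>-1$, $\beta>0$ and, for $n\ge1$, put $$\chi_n=-\frac{2(\alpha+n)(n+\alpha+\beta-1)}{(2n+\alpha+\beta-1)(2n+\alpha+\beta-2)} .$$ Then: (i) $(\chi_n)$ satisfies, for all $n\ge2$, the nonlinear difference equation $$c^g_{n+1}-c^g_n+\chi_n-\chi_{n+1}-\frac{\lambda^g_{n+1}}{\chi_n}+\frac{\lambda^g_n}{\chi_{n-1}}=0 .$$ (ii) For all $n\ge1$, the quasi-Geronimus Jacobi polynomial $P^{QG}_n(x;-1)=\mathcal P^{(\alpha,\beta-1)}_n(x)+\chi_n\mathcal P^{(\alpha,\beta-1)}_{n-1}(x)$ equals $(x-1)\,\mathcal P^{(\alpha+1,\beta-1)}_{n-1}(x)$. (iii) For all $n\ge2$, $$P^{QG}_{n+1}(x;-1)=(x-c^{qg}_{n+1})P^{QG}_n(x;-1)-\lambda^{qg}_{n+1}P^{QG}_{n-1}(x;-1),$$ where $$\lambda^{qg}_{n+1}=\frac{4(n-1)(n+\alpha)(n+\beta-2)(n+\alpha+\beta-1)}{(2n+\alpha+\beta-2)^2(2n+\alpha+\beta-1)(2n+\alpha+\beta-3)},\qquad c^{qg}_{n+1}=\frac{(\beta-\alpha-2)(\beta+\alpha)}{(2n+\alpha+\beta-2)(2n+\alpha+\beta)} .$$ (iv) The polynomials $P^{QG}_n(x;-1)$, $n\ge2$, are orthogonal with respect to $d\mu(x)=(1-x)^{\alpha-1}(1+x)^{\beta-1}\,dx$ on $(-1,1)$. (v) The sequences $(\lambda^{qg}_{n+1})_{n\ge2}$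 and $(c^{qg}_{n+1})_{n\ge2}$ are bounded, and $\lambda^{qg}_{n+1}\to\tfrac14$, $c^{qg}_{n+1}\to0$ as $n\to\infty$ (the Nevai class $\mathbb N(1/4,0)$).
   Context: For $a,b>-1$, $\mathcal P^{(a,b)}_n(x)$ denotes the monic Jacobi polynomial of degree $n$, i.e. the monic polynomials orthogonal on $(-1,1)$ with respect to the weight $(1-x)^a(1+x)^b$. The polynomials $\mathcal P^{(\alpha,\beta-1)}_n$ (the Geronimus transform at $-1$ of $\mathcal P^{(\alpha,\beta)}_n$, for $\alpha>-1$, $\beta>0$) satisfy $\mathcal P^{(\alpha,\beta-1)}_{n+1}(x)=(x-c^g_{n+1})\mathcal P^{(\alpha,\beta-1)}_n(x)-\lambda^g_{n+1}\mathcal P^{(\alpha,\beta-1)}_{n-1}(x)$ for $n\ge1$ with $$\lambda^g_{n+1}=\frac{4n(n+\alpha)(n+\beta-1)(n+\alpha+\beta-1)}{(2n+\alpha+\beta-1)^2(2n+\alpha+\beta)(2n+\alpha+\beta-2)},\qquad c^g_{n+1}=\frac{(\beta-1)^2-\alpha^2}{(2n+\alpha+\beta-1)(2n+\alpha+\beta+1)} .$$ Convention: for $n=1$ the common factor $\alpha+\beta$ in the numerator and denominator of $\chi_1$ and of $\lambda^g_2$ is cancelled (this matters only when $\alpha+\beta=0$). A measure is said to belong to the Nevai class $\mathbb N(A,B)$ if the recurrence coefficients $\lambda_n$, $c_n$ of its monic orthogonal polynomials satisfy $\lambda_n\to A$, $c_n\to B$. A family of polynomials $(p_n)_{n\ge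 n_0}$ is orthogonal with respect to a measure $\mu$ if $\int p_np_m\,d\mu$ converges absolutely for all $n,m\ge n_0$, is $0$ for $n\ne m$ and is nonzero for $n=m$. *)

(* Defs.v *)
From HB Require Import structures.
From mathcomp Require Import all_boot all_order all_algebra.
From mathcomp Require Import all_classical all_reals all_analysis.

Set Implicit Arguments.
Unset Strict Implicit.
Unset Printing Implicit Defensive.

Import Order.TTheory GRing.Theory Num.Theory.
Import numFieldNormedType.Exports.

Local Open Scope classical_set_scope.
Local Open Scope ring_scope.

(* Orthogonality with respect to the measure w(x) dx on D. That measure may
   be infinite, so integrability of each product is part of the definition:
   Rintegral would be a junk value otherwise. *)
Definition orthogonal_from (R : realType) (D : set R) (w : R -> R)
    (n0 : nat) (p : nat -> {poly R}) : Prop :=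
  forall n m : nat, (n0 <= n)%N -> (n0 <= m)%N ->
  [/\ (@lebesgue_measure R).-integrable D
        (EFin \o (fun x => (p n).[x] * (p m).[x] * w x)),
      n <> m ->
        \int[@lebesgue_measure R]_(x in D) ((p n).[x] * (p m).[x] * w x) = 0 &
      n = m ->
        \int[@lebesgue_measure R]_(x in D) ((p n).[x] * (p m).[x] * w x) <> 0].

Definition monic_orthogonal (R : realType) (D : set R) (w : R -> R)
    (p : nat -> {poly R}) : Prop :=
  (forall n, p n \is monic /\ size (p n) = n.+1) /\ orthogonal_from D w 0 p.

Definition jacobi_weight (R : realType) (a b : R) (x : R) : R :=
  (1 - x) `^ a * (1 + x) `^ b.

(* Definite description: for a, b > -1 there is exactly one such sequence;
   the default value 0 only matters outside this range. *)
Definition jacobi (R : realType) (a b : R) : nat -> {poly R} :=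
  xget (fun=> 0)
    [set p | monic_orthogonal `]-1, 1[%classic (jacobi_weight a b) p].

(* The recurrence coefficients below are indexed by the subscript k = n + 1 of
   lambda_{n+1} and c_{n+1}, so that n = k.-1 in the closed formulas.
   In lambda_g 2 and chi 1 the common factor alpha + beta of numerator and
   denominator is cancelled, as it may vanish. *)
Definition lambda_g (R : realType) (alpha beta : R) (k : nat) : R :=
  let n : R := k.-1%:R in
  if k == 2%N then
    4 * (1 + alpha) * beta
      / ((alpha + beta + 1) ^+ 2 * (alpha + beta + 2))
  else
    4 * n * (n + alpha) * (n + beta - 1) * (n + alpha + beta - 1)
      / ((2 * n + alpha + beta - 1) ^+ 2 * (2 * n + alpha + beta)
         * (2 * n + alpha + beta - 2)).

Definition c_g (R : realType) (alpha beta : R) (k : nat) : R :=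
  let n : R := k.-1%:R in
  ((beta - 1) ^+ 2 - alpha ^+ 2)
    / ((2 * n + alpha + beta - 1) * (2 * n + alpha + beta + 1)).

Definition chi (R : realType) (alpha beta : R) (n : nat) : R :=
  if n == 1%N then - (2 * (alpha + 1) / (alpha + beta + 1))
  else
    - (2 * (alpha + n%:R) * (n%:R + alpha + beta - 1)
        / ((2 * n%:R + alpha + beta - 1) * (2 * n%:R + alpha + beta - 2))).

Definition lambda_qg (R : realType) (alpha beta : R) (k : nat) : R :=
  let n : R := k.-1%:R in
  4 * (n - 1) * (n + alpha) * (n + beta - 2) * (n + alpha + beta - 1)
    / ((2 * n + alpha + beta - 2) ^+ 2 * (2 * n + alpha + beta - 1)
       * (2 * n + alpha + beta - 3)).

Definition c_qg (R : realType) (alpha beta : R) (k : nat) : R :=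
  let n : R := k.-1%:R in
  (beta - alpha - 2) * (beta + alpha)
    / ((2 * n + alpha + beta - 2) * (2 * n + alpha + beta)).

(* Meaningful for n >= 1 only. *)
Definition quasi_geronimus (R : realType) (alpha beta : R) (n : nat) :
    {poly R} :=
  jacobi alpha (beta - 1) n
    + chi alpha beta n *: jacobi alpha (beta - 1) n.-1.

(* Main.v *)
Require Import Defs.
From HB Require Import structures.
From mathcomp Require Import all_boot all_order all_algebra.
From mathcomp Require Import all_classical all_reals all_analysis.
From mathcomp Require Import measurable_realfun ring lra zify.

Import Order.TTheory GRing.Theory Num.Theory.
Import numFieldNormedType.Exports.

Local Open Scope classical_set_scope.
Local Open Scope ring_scope.

(** The polynomial P^QG_n is (x - 1) P^(alpha+1,beta-1)_(n-1), and the rest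
    follows from this factorization.  Indeed, against the weight (alpha, beta-1)
    the polynomial (x - 1) P^(alpha+1,beta-1)_(n-1) is orthogonal to everything
    of degree < n - 1, because its factor 1 - x turns the weight into
    (alpha+1, beta-1).  Being monic of degree n, it is therefore
    P^(alpha,beta-1)_n plus a multiple of P^(alpha,beta-1)_(n-1); comparing the
    coefficients of degree n - 1 shows that the multiple is chi_n
    ([jacobi_shift], [quasi_geronimusE]).  Consequently

    - the recurrence of P^QG_n is the three-term recurrence of
      P^(alpha+1,beta-1)_(n-1) multiplied by x - 1 ([jacobi_recurrence]);
    - the square of the factor x - 1 turns the weight (alpha-1, beta-1), which
      need not be integrable at 1, into (alpha+1, beta-1), so orthogonality for
      the former is orthogonality of the Jacobi polynomials for the latter;
    - the difference equation for chi_n and the limits of the coefficients are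
      statements about explicit rational functions of n.

    Since [jacobi] is a definite description, the Jacobi polynomials must be
    shown to exist and to be unique, and two of their coefficients must be
    known.  With t = x - 1 the equation
      (1 - x^2) y'' + (b - a - (a+b+2) x) y' = - n (n+a+b+1) y
    is a two-term recurrence on the coefficients of t^k, solved by an explicit
    product ([shifted_jacobi]).  The differential operator is symmetric for the
    moment functional by the Pearson identity
      int ((1 - x^2) p' + (b - a - (a+b+2) x) p) w = 0
    ([jacobi_pearson]), which is the fundamental theorem of calculus for
    p (1-x)^(a+1) (1+x)^(b+1), a function vanishing at both ends.
    Eigenpolynomials for distinct eigenvalues are then orthogonal
    ([explicit_jacobi_orthogonal]).  Uniqueness comes from the positivity of
    the functional on squares ([jacobi_int_sqr_eq0]), and it identifies [jacobi]
    with the explicit solution ([jacobi_explicit]). *)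

(** * Improper integrals over a bounded open interval *)

Section improper_integrals.
Context {R : realType}.
Notation mu := (@lebesgue_measure R).

Lemma itv_oo_exhaustion (a b : R) : a < b ->
  \bigcup_n `[a + (b - a) / n.+3%:R, b - (b - a) / n.+3%:R]%classic
  = `]a, b[%classic.
Proof.
move=> ab; apply/seteqP; split=> [x [n _]|x] /=; rewrite !in_itv/=.
  have : 0 < (b - a) / n.+3%:R by rewrite divr_gt0 ?subr_gt0.
  by move: (_ / _) => e ? /andP[? ?]; apply/andP; split; lra.
move=> /andP[ax xb].
pose m := Num.min (x - a) (b - x).
have m0 : 0 < m by rewrite lt_min !subr_gt0 ax.
have [n nm] : exists n : nat, (b - a) / m < n%:R.
  exists (Num.Def.archi_bound ((b - a) / m)); apply: archi_boundP.
  by rewrite divr_ge0 ?ltW// subr_gt0.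
exists n => //=; rewrite in_itv/=.
have : (b - a) / n.+3%:R <= m.
  rewrite ler_pdivrMr// -ler_pdivrMl// mulrC (le_trans (ltW nm))//.
  by rewrite ler_nat -addn3 leq_addr.
move: (_ / _) => e; rewrite le_min => /andP[? ?]; apply/andP; split; lra.
Qed.

(** On the compact intervals exhausting ]a, b[ the integral of f is a
    difference of two values of F, hence at most 2 M; monotone convergence
    carries the bound over to ]a, b[. *)
Lemma ge0_primitive_integrable (f F : R -> R) (a b M : R) : a < b ->
  {in `]a, b[, continuous f} -> {in `]a, b[, forall x, 0 <= f x} ->
  (forall x, x \in `]a, b[ -> is_derive x 1 F (f x)) ->
  {in `]a, b[, forall x, `|F x| <= M} ->
  mu.-integrable `]a, b[ (EFin \o f).
Proof.
move=> ab cf f0 dF FM.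
have mf : measurable_fun `]a, b[ f.
  by apply: open_continuous_measurable_fun => // x; rewrite inE/=; exact: cf.
apply/integrableP; split; first exact/measurable_EFinP.
pose S n := `[a + (b - a) / n.+3%:R, b - (b - a) / n.+3%:R]%classic.
have SI n : S n `<=` `]a, b[%classic.
  by rewrite -itv_oo_exhaustion//; exact: bigcup_sup.
have mf' n : measurable_fun (S n) (EFin \o f).
  by apply/measurable_EFinP; apply: measurable_funS mf => //; exact: SI.
have ndS : nondecreasing_seq S.
  move=> n m nm; apply/subsetPset => x; rewrite /S/= !in_itv/=.
  have : (b - a) / m.+3%:R <= (b - a) / n.+3%:R.
    by rewrite ler_pM2l ?subr_gt0// lef_pV2 ?posrE// ler_nat !ltnS.
  move: (_ / m.+3%:R) (_ / n.+3%:R) => e e' ? /andP[? ?].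
  by apply/andP; split; lra.
have S0 n x : S n x -> (0 <= (EFin \o f) x)%E.
  by move=> /SI Sx; rewrite lee_fin f0.
under eq_integral => x /set_mem xab do rewrite /= ger0_norm ?f0//.
rewrite -itv_oo_exhaustion//.
have cv : (\int[mu]_(x in S i) (f x)%:E @[i --> \oo] -->
    \int[mu]_(x in \bigcup_i S i) (f x)%:E)%E.
  apply: ge0_nondecreasing_set_cvg_integral => // n; exact: measurable_itv.
rewrite (@le_lt_trans _ _ (M + M)%:E) ?ltry//.
move/cvg_lim : (cv) => <-//.
apply: lime_le; first by apply/cvg_ex; eexists; exact: cv.
near=> n.
have ltS : a + (b - a) / n.+3%:R < b - (b - a) / n.+3%:R.
  suff : (b - a) / n.+3%:R * 2 < b - a by move: (_ / _) => e ?; lra.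
  rewrite -mulrA gtr_pMr ?subr_gt0// mulrC ltr_pdivrMr// mul1r ltr_nat//.
have inS x : x \in `[a + (b - a) / n.+3%:R, b - (b - a) / n.+3%:R] ->
    x \in `]a, b[.
  by move=> xS; have /= := SI n x; apply.
rewrite (@continuous_FTC2 _ f F)//.
- rewrite -EFinB lee_fin (le_trans (ler_norm _))// (le_trans (ler_normB _ _))//.
  by rewrite lerD// FM// inS// bound_itvE ltW.
- apply/continuous_in_subspaceT => x; rewrite inE/= => /inS; exact: cf.
- split.
  + by move=> x /subset_itv_oo_cc/inS/dF[].
  + apply: cvg_at_right_filter; apply: differentiable_continuous.
    apply/derivable1_diffP.
    have [] // := dF (a + (b - a) / n.+3%:R) (inS _ _).
    by rewrite bound_itvE ltW.
  + apply: cvg_at_left_filter; apply: differentiable_continuous.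
    apply/derivable1_diffP.
    have [] // := dF (b - (b - a) / n.+3%:R) (inS _ _).
    by rewrite bound_itvE ltW.
- by move=> x /subset_itv_oo_cc/inS/dF[_ <-]; rewrite derive1E.
Unshelve. all: by end_near. Qed.

(** Here f may be unbounded at a and b, so that the version for functions
    continuous on [a, b] does not apply.  Integrability alone makes
    G x = int_a^x f continuous up to the end points, and F - G has zero
    derivative inside: the mean value theorem gives F b - G b = F a - G a. *)
Lemma integrable_FTC (f F : R -> R) (a b : R) : a < b ->
  mu.-integrable `]a, b[ (EFin \o f) ->
  {in `]a, b[, continuous f} ->
  derivable_oo_LRcontinuous F a b ->
  {in `]a, b[, F^`()%classic =1 f} ->
  \int[mu]_(x in `]a, b[) f x = F b - F a.
Proof.
move=> ab intf cf dF dFE.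
have intfc : mu.-integrable `[a, b] (EFin \o f).
  have mf : measurable_fun `]a, b[ f.
    by apply/measurable_EFinP; exact: measurable_int intf.
  apply/integrableP; split.
    apply/measurable_EFinP; apply: measurable_fun_itv_cc mf.
  have /integrableP[mf' +] := intf.
  by rewrite (integral_itv_bndoo true false)//; exact: measurableT_comp.
pose G x := \int[mu]_(t in `[a, x]) f t.
have cG : {within `[a, b], continuous G}.
  exact: parameterized_integral_continuous (ltW ab) intfc.
have dG x : x \in `]a, b[ -> is_derive x 1 G (f x).
  move=> xab; have /andP[ax xb] := xab.
  rewrite !bnd_simp in ax xb.
  have [dGx GE] := continuous_FTC1_closed xb intfc ax (cf x xab).
  by apply: DeriveDef; [exact: dGx|rewrite -derive1E].
have [||c cab] := @MVT _ (F - G) (fun=> 0) a b ab.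
- move=> x xab; rewrite -(subrr (f x)); apply: is_deriveB; last exact: dG.
  by apply: DeriveDef; [case: dF => + _ _; apply|rewrite -derive1E dFE].
- move=> x; apply: cvgB; last exact: cG.
  exact: derivable_oo_LRcontinuous_within.
rewrite mul0r !fctE.
have -> : G a = 0 by rewrite /G set_itv1 Rintegral_set1.
rewrite subr0 => FG.
have -> : \int[mu]_(x in `]a, b[) f x = G b.
  rewrite /G -Rintegral_itv_obnd_cbnd ?Rintegral_itv_bndo_bndc//.
  apply: integrableS intfc => //; exact: subset_itv_oc_cc.
lra.
Qed.
End improper_integrals.

(** * The moment functional of the Jacobi weight *)

Section jacobi_functional.
Context {R : realType}.
Notation mu := (@lebesgue_measure R).
Notation D := (`]-1, 1[%classic : set R).

Lemma is_derive_powR_onem (a x : R) : x < 1 ->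
  is_derive x 1 (fun y => (1 - y) `^ a) (- (a * (1 - x) `^ (a - 1))).
Proof.
move=> x1; have h : 0 < 1 - x by rewrite subr_gt0.
have dl : is_derive x 1 (fun y : R => 1 - y) (- 1).
  by rewrite -[X in is_derive _ _ _ X]add0r; apply: is_deriveB.
apply: trigger_derive.
  apply: (@is_derive1_comp _ (fun z => z `^ a) (fun y => 1 - y)) => //.
  exact: is_derive1_powR.
by rewrite mulrN1.
Qed.

Lemma is_derive_powR_addr (a x : R) : -1 < x ->
  is_derive x 1 (fun y => (1 + y) `^ a) (a * (1 + x) `^ (a - 1)).
Proof.
move=> x1; have h : 0 < 1 + x by lra.
have dl : is_derive x 1 (fun y : R => 1 + y) 1.
  by rewrite -[X in is_derive _ _ _ X]add0r; apply: is_deriveD.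
apply: trigger_derive.
  apply: (@is_derive1_comp _ (fun z => z `^ a) (fun y => 1 + y)) => //.
  exact: is_derive1_powR.
by rewrite mulr1.
Qed.

Lemma continuous_powR_onem (a x : R) : x < 1 ->
  {for x, continuous (fun y : R => (1 - y) `^ a)}.
Proof.
move=> x1; apply/differentiable_continuous/derivable1_diffP.
by have [] := is_derive_powR_onem a x x1.
Qed.

Lemma continuous_powR_addr (a x : R) : -1 < x ->
  {for x, continuous (fun y : R => (1 + y) `^ a)}.
Proof.
move=> x1; apply/differentiable_continuous/derivable1_diffP.
by have [] := is_derive_powR_addr a x x1.
Qed.

Lemma powR_le_powR2 (c y : R) : 0 <= c -> 0 <= y <= 2 -> y `^ c <= 2 `^ c.
Proof. by move=> c0 /andP[? ?]; rewrite ge0_ler_powR// nnegrE. Qed.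

Lemma powR_onem_integrable (a : R) : -1 < a ->
  mu.-integrable D (EFin \o (fun x => (1 - x) `^ a)).
Proof.
move=> a1; have a0 : 0 < a + 1 by lra.
apply: (@ge0_primitive_integrable _ _
  (fun x => (- (a + 1)^-1) * (1 - x) `^ (a + 1)) _ _
  ((a + 1)^-1 * 2 `^ (a + 1))).
- lra.
- by move=> x; rewrite in_itv/= => /andP[_]; exact: continuous_powR_onem.
- by move=> x _; exact: powR_ge0.
- move=> x; rewrite in_itv/= => /andP[_ x1].
  have dp := is_derive_powR_onem (a + 1) x x1.
  have dq := is_deriveM (is_derive_cst (- (a + 1)^-1 : R) (x : R) (1 : R)) dp.
  apply: (trigger_derive dq).
  rewrite addrK /GRing.scale/= mulr0 addr0 mulrNN mulrA.
  by rewrite mulVf ?mul1r// gt_eqF.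
- move=> x; rewrite in_itv/= => /andP[? ?].
  rewrite normrM normrN (ger0_norm (powR_ge0 _ _)).
  rewrite ger0_norm ?invr_ge0 ?(ltW a0)//.
  rewrite ler_pM2l ?invr_gt0//; apply: powR_le_powR2; [lra|].
  by apply/andP; split; lra.
Qed.

Lemma powR_addr_integrable (a : R) : -1 < a ->
  mu.-integrable D (EFin \o (fun x => (1 + x) `^ a)).
Proof.
move=> a1; have a0 : 0 < a + 1 by lra.
apply: (@ge0_primitive_integrable _ _
  (fun x => (a + 1)^-1 * (1 + x) `^ (a + 1)) _ _
  ((a + 1)^-1 * 2 `^ (a + 1))).
- lra.
- by move=> x; rewrite in_itv/= => /andP[+ _]; exact: continuous_powR_addr.
- by move=> x _; exact: powR_ge0.
- move=> x; rewrite in_itv/= => /andP[x1 _].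
  have dp := is_derive_powR_addr (a + 1) x x1.
  have dq := is_deriveM (is_derive_cst ((a + 1)^-1 : R) (x : R) (1 : R)) dp.
  apply: (trigger_derive dq).
  by rewrite addrK /GRing.scale/= mulr0 addr0 mulrA mulVf ?mul1r// gt_eqF.
- move=> x; rewrite in_itv/= => /andP[? ?].
  rewrite normrM (ger0_norm (powR_ge0 _ _)) ger0_norm ?invr_ge0 ?(ltW a0)//.
  rewrite ler_pM2l ?invr_gt0//; apply: powR_le_powR2; [lra|].
  by apply/andP; split; lra.
Qed.

Lemma powR_le_onep_powR2 (b y : R) : 1 <= y <= 2 -> y `^ b <= 1 + 2 `^ b.
Proof.
move=> /andP[y1 y2]; have [b0|b0] := leP 0 b.
  rewrite (le_trans (powR_le_powR2 _ _ b0 _)) ?lerDr//.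
  by apply/andP; split; lra.
rewrite (@le_trans _ _ 1) ?lerDl ?powR_ge0//.
by rewrite -(powRr0 y) ler_powR// ltW.
Qed.

Lemma jacobi_weight_continuous (a b : R) :
  {in `]-1, 1[, continuous (jacobi_weight a b)}.
Proof.
move=> x; rewrite in_itv/= => /andP[x0 x1].
by apply: cvgM; [exact: continuous_powR_onem|exact: continuous_powR_addr].
Qed.

Lemma jacobi_weight_gt0 (a b x : R) : x \in `]-1, 1[ -> 0 < jacobi_weight a b x.
Proof.
by rewrite in_itv/= => /andP[? ?]; rewrite mulr_gt0// powR_gt0//; lra.
Qed.

Lemma horner_jacobi_weight_continuous (a b : R) (p : {poly R}) :
  {in `]-1, 1[, continuous (fun x => p.[x] * jacobi_weight a b x)}.
Proof.
move=> x xD; apply: cvgM; first exact: continuous_horner.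
exact: jacobi_weight_continuous.
Qed.

(** Each factor of the weight is singular at one end only and bounded near the
    other one, so that the weight is dominated by a linear combination of
    (1 - x)^a and (1 + x)^b, which have explicit bounded primitives. *)
Lemma jacobi_weight_integrable (a b : R) (p : {poly R}) : -1 < a -> -1 < b ->
  mu.-integrable D (EFin \o (fun x => p.[x] * jacobi_weight a b x)).
Proof.
move=> a1 b1.
pose M := \sum_(i < size p) `|p`_i|.
have intg : mu.-integrable D (fun x =>
   M%:E * ((1 + 2 `^ b)%:E * ((1 - x) `^ a)%:E
           + (1 + 2 `^ a)%:E * ((1 + x) `^ b)%:E))%E.
  apply: integrableZl => //; apply: integrableD => //;
    apply: integrableZl => //.
    exact: powR_onem_integrable.
  exact: powR_addr_integrable.
apply: le_integrable intg => //.
  apply/measurable_EFinP; apply: open_continuous_measurable_fun => // x.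
  by rewrite inE; exact: horner_jacobi_weight_continuous.
move=> x xD /=; have /andP[x0 x1] := xD; rewrite !bnd_simp in x0 x1.
rewrite lee_fin.
have pM : `|p.[x]| <= M.
  rewrite horner_coef (le_trans (ler_norm_sum _ _ _))// ler_sum// => i _.
  rewrite normrM normrX ler_piMr// exprn_ile1// ler_norml.
  by apply/andP; split; lra.
have M0 : 0 <= M by rewrite sumr_ge0.
have Pa := powR_ge0 (1 - x) a; have Pb := powR_ge0 (1 + x) b.
have P2a := powR_ge0 2 a; have P2b := powR_ge0 2 b.
rewrite normrM [leRHS]ger0_norm; last first.
  by rewrite mulr_ge0// addr_ge0// mulr_ge0// addr_ge0.
rewrite ler_pM// ger0_norm ?mulr_ge0//.
have [x00|x00] := leP 0 x.
  have h : (1 + x) `^ b <= 1 + 2 `^ b.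
    by apply: powR_le_onep_powR2; apply/andP; split; lra.
  by rewrite /jacobi_weight mulrC; nra.
have h : (1 - x) `^ a <= 1 + 2 `^ a.
  by apply: powR_le_onep_powR2; apply/andP; split; lra.
by rewrite /jacobi_weight mulrC; nra.
Qed.

Definition jacobi_int (a b : R) (p : {poly R}) : R :=
  \int[mu]_(x in D) (p.[x] * jacobi_weight a b x).

Lemma jacobi_intD (a b : R) (p q : {poly R}) : -1 < a -> -1 < b ->
  jacobi_int a b (p + q) = jacobi_int a b p + jacobi_int a b q.
Proof.
move=> a1 b1; rewrite /jacobi_int -RintegralD//;
  try exact: jacobi_weight_integrable.
by apply: eq_Rintegral => x _; rewrite hornerD mulrDl.
Qed.

Lemma jacobi_intZ (a b c : R) (p : {poly R}) : -1 < a -> -1 < b ->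
  jacobi_int a b (c *: p) = c * jacobi_int a b p.
Proof.
move=> a1 b1; rewrite /jacobi_int -RintegralZl//;
  try exact: jacobi_weight_integrable.
by apply: eq_Rintegral => x _; rewrite hornerZ -mulrA.
Qed.

Lemma jacobi_intB (a b : R) (p q : {poly R}) : -1 < a -> -1 < b ->
  jacobi_int a b (p - q) = jacobi_int a b p - jacobi_int a b q.
Proof.
by move=> a1 b1; rewrite jacobi_intD// -scaleN1r jacobi_intZ// mulN1r.
Qed.

Lemma jacobi_int_shift (a b : R) (p : {poly R}) :
  jacobi_int (a + 1) b p = jacobi_int a b ((1 - 'X) * p).
Proof.
apply: eq_Rintegral => x; rewrite inE/= in_itv/= => /andP[x0 x1].
rewrite /jacobi_weight powRD; last by apply/implyP => _; lra.
rewrite powRr1; last by lra.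
by rewrite !hornerE/=; ring.
Qed.

(** If the integral of p^2 w vanishes then p^2 w vanishes almost everywhere;
    as w > 0, the finite set of roots of p would have measure 2. *)
Lemma jacobi_int_sqr_eq0 (a b : R) (p : {poly R}) : -1 < a -> -1 < b ->
  jacobi_int a b (p * p) = 0 -> p = 0.
Proof.
move=> a1 b1 int0; apply/eqP/negPn/negP => p0.
have intp := @jacobi_weight_integrable a b (p * p) a1 b1.
have : (\int[mu]_(x in D) `|((p * p).[x] * jacobi_weight a b x)%:E| = 0)%E.
  transitivity (\int[mu]_(x in D) ((p * p).[x] * jacobi_weight a b x)%:E)%E.
    apply: eq_integral => x /set_mem xD; rewrite gee0_abs// lee_fin.
    by rewrite mulr_ge0 ?hornerM -?expr2 ?sqr_ge0// ltW// jacobi_weight_gt0.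
  move: int0; rewrite /jacobi_int /Rintegral => h.
  by rewrite -[LHS]fineK ?h//; exact: integrable_fin_num.
move/ae_eq_integral_abs => -[//||N [mN N0 sN]].
  by apply: measurable_int; exact: intp.
have finr : finite_set [set x | root p x].
  apply: contrapT => /(@infinite_set_fset _ _ (size p))[B sB].
  rewrite leqNgt max_poly_roots//; last exact: finmap.fset_uniq.
  by apply/allP => x /sB.
have cr := finite_set_countable finr.
have mr : measurable [set x | root p x].
  by apply: countable_measurable => // x; exact: measurable_set1.
have : (mu D <= mu N + mu [set x | root p x])%E.
  apply: (@le_trans _ _ (mu (N `|` [set x | root p x]))); last exact: measureU2.
  apply: le_measure; rewrite ?inE//; first exact: measurableU.
  move=> x xD; have [rx|rx] := boolP (root p x); [by right|left].
  apply: sN => /= /(_ xD)/eqP; rewrite hornerM.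
  rewrite eqe mulf_eq0 mulf_eq0 orbb -/(root p x) (negbTE rx)/=.
  by rewrite gt_eqF// jacobi_weight_gt0.
rewrite N0 add0e (countable_lebesgue_measure0 cr).
rewrite lebesgue_measure_itv/= lte_fin ifT; last by lra.
by rewrite -EFinB lee_fin; lra.
Qed.

(** The exponents a + 1 and b + 1 are positive, so the primitive used in the
    Pearson identity tends to 0 at both ends. *)
Lemma jacobi_primitive_LRcontinuous (a b : R) (p : {poly R}) :
  -1 < a -> -1 < b ->
  derivable_oo_LRcontinuous
    (fun x => p.[x] * jacobi_weight (a + 1) (b + 1) x) (-1) 1.
Proof.
move=> a1 b1.
have a0 : 0 < a + 1 by lra.
have b0 : 0 < b + 1 by lra.
have c1 : (1 - x) `^ (a + 1) @[x --> (1:R)^'-] --> (0 : R).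
  apply: (cvg_comp (fun x => 1 - x) (fun y => y `^ (a + 1)) _
    (powR_cvg0 a0)).
  move=> A [d /= d0 dA]; exists d => // x /= xd x1; apply: dA => /=.
    by rewrite sub0r normrN.
  by rewrite subr_gt0.
have c2 : (1 + x) `^ (b + 1) @[x --> (-1:R)^'+] --> (0 : R).
  apply: (cvg_comp (fun x => 1 + x) (fun y => y `^ (b + 1)) _
    (powR_cvg0 b0)).
  move=> A [d /= d0 dA]; exists d => // x /= xd x1; apply: dA => /=.
    by rewrite sub0r opprD.
  by lra.
split.
- move=> x; rewrite in_itv/= => /andP[x0 x1].
  apply: derivableM; first exact: derivable_horner.
  apply: derivableM.
    by have [] := is_derive_powR_onem (a + 1) x x1.
  by have [] := is_derive_powR_addr (b + 1) x x0.
- rewrite {2}/jacobi_weight subrr powR0 ?gt_eqF// !mulr0.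
  rewrite -[X in _ --> X](mulr0 (p.[-1])); apply: cvgM.
    by apply: cvg_at_right_filter; exact: continuous_horner.
  rewrite -[X in _ --> X](mulr0 ((1 - -1) `^ (a + 1))); apply: cvgM => //.
  by apply: cvg_at_right_filter; apply: continuous_powR_onem; lra.
- rewrite {2}/jacobi_weight subrr powR0 ?gt_eqF// mul0r mulr0.
  rewrite -[X in _ --> X](mulr0 (p.[1])); apply: cvgM.
    by apply: cvg_at_left_filter; exact: continuous_horner.
  rewrite -[X in _ --> X](mul0r ((1 + 1) `^ (b + 1))); apply: cvgM => //.
  by apply: cvg_at_left_filter; apply: continuous_powR_addr; lra.
Qed.

(** The integrand is the derivative of p (1-x)^(a+1) (1+x)^(b+1). *)
Lemma jacobi_pearson (a b : R) (p : {poly R}) : -1 < a -> -1 < b ->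
  jacobi_int a b
    ((1 - 'X ^+ 2) * p^`() + ((b - a)%:P - (a + b + 2) *: 'X) * p) = 0.
Proof.
move=> a1 b1; have a0 : 0 < a + 1 by lra.
have b0 : 0 < b + 1 by lra.
have dF := jacobi_primitive_LRcontinuous a b p a1 b1.
have lt11 : (-1 : R) < 1 by lra.
rewrite /jacobi_int (integrable_FTC _ _ _ _ lt11
  (jacobi_weight_integrable _ _ _ a1 b1)
  (horner_jacobi_weight_continuous _ _ _) dF).
  by rewrite /jacobi_weight subrr !powR0 ?gt_eqF// !(mul0r, mulr0) subrr.
move=> x xD; have := xD; rewrite in_itv/= => /andP[x0 x1].
rewrite derive1E.
have d := is_deriveM (is_derive_poly p x)
  (is_deriveM (is_derive_powR_onem (a + 1) x x1)
              (is_derive_powR_addr (b + 1) x x0)).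
have [_ ->] := d.
rewrite !fctE !addrK /jacobi_weight /GRing.scale/= !powRD ?powRr1;
  try by [lra|apply/implyP => _; lra].
by rewrite !hornerE /=; ring.
Qed.
End jacobi_functional.

(** * An explicit solution of the Jacobi differential equation *)

Section shifted_jacobi.
Context {R : realType}.

(** The monic Jacobi polynomial written in the variable t = x - 1: the
    factors are the successive ratios prescribed by the two-term recurrence
    [shifted_jacobi_rec], started from the leading coefficient 1. *)
Definition shifted_jacobi (a b : R) (n : nat) : {poly R} :=
  \poly_(k < n.+1) \prod_(k <= j < n)
    (2 * j.+1%:R * (j.+1%:R + a)
      / ((n%:R - j%:R) * (n%:R + j%:R + a + b + 1))).

Lemma coef_shifted_jacobi_lead (a b : R) (n : nat) :
  (shifted_jacobi a b n)`_n = 1.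
Proof. by rewrite coef_poly ltnS leqnn big_geq. Qed.

Lemma size_shifted_jacobi (a b : R) (n : nat) :
  size (shifted_jacobi a b n) = n.+1.
Proof. by apply: size_poly_eq; rewrite big_geq// oner_eq0. Qed.

Lemma coef_shifted_jacobi_gt (a b : R) (n k : nat) : (n < k)%N ->
  (shifted_jacobi a b n)`_k = 0.
Proof. by move=> nk; rewrite nth_default// size_shifted_jacobi. Qed.

Lemma shifted_jacobi_rec (a b : R) (n k : nat) : -1 < a -> -1 < b ->
  (n%:R - k%:R) * (n%:R + k%:R + a + b + 1) * (shifted_jacobi a b n)`_k
  = 2 * k.+1%:R * (k.+1%:R + a) * (shifted_jacobi a b n)`_k.+1.
Proof.
move=> a1 b1; have [nk|kn] := leqP n k.
  rewrite (coef_shifted_jacobi_gt a b n k.+1)// mulr0.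
  move: nk; rewrite leq_eqVlt => /predU1P[->|nk]; first by rewrite subrr !mul0r.
  by rewrite coef_shifted_jacobi_gt// mulr0.
rewrite !coef_poly !ltnS kn ltnW// big_ltn// mulrA; congr (_ * _).
have n1 : (k%:R + 1 : R) <= n%:R by rewrite natr1 ler_nat.
have k0 : (0 : R) <= k%:R by [].
rewrite mulrC divfK// mulf_neq0// gt_eqF//; lra.
Qed.

(** The factor 'X makes the formula valid for n = 0, where the coefficient of
    degree n - 1 has to be read as 0; this also covers the case when the
    denominator vanishes there. *)
Lemma coef_shifted_jacobi_sub1 (a b : R) (n : nat) : -1 < a -> -1 < b ->
  ('X * shifted_jacobi a b n)`_n = 2 * n%:R * (n%:R + a) / (2 * n%:R + a + b).
Proof.
move=> a1 b1; rewrite coefXM; case: n => [|n] /=; first by rewrite mulr0 !mul0r.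
have := @shifted_jacobi_rec a b n.+1 n a1 b1.
have n0 : (0 : R) <= n%:R by [].
rewrite coef_shifted_jacobi_lead mulr1 -natr1 => h.
have d0 : 2 * (n%:R + 1) + a + b != 0 :> R by rewrite gt_eqF//; lra.
by apply: (mulfI d0); rewrite mulrCA divff// mulr1 -h; ring.
Qed.

Lemma coef_shifted_jacobi_sub2 (a b : R) (n : nat) : -1 < a -> -1 < b ->
  ('X * ('X * shifted_jacobi a b n))`_n =
  2 * n%:R * (n%:R + a) / (2 * n%:R + a + b)
  * ((n%:R - 1) * (n%:R - 1 + a) / (2 * n%:R + a + b - 1)).
Proof.
move=> a1 b1; rewrite coefXM; case: n => [|n] /=; first by rewrite mulr0 !mul0r.
rewrite coefXM; case: n => [|n] /=; first by rewrite subrr !mul0r mulr0.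
rewrite -coef_shifted_jacobi_sub1// coefXM/=.
have := @shifted_jacobi_rec a b n.+2 n a1 b1.
have n0 : (0 : R) <= n%:R by [].
rewrite -[n.+2%:R]natr1 -[n.+1%:R]natr1 => h.
have d0 : 2 * (n%:R + 1 + 1) + a + b - 1 != 0 :> R by rewrite gt_eqF//; lra.
have d2 : 2 * (2 * (n%:R + 1 + 1) + a + b - 1) != 0 :> R.
  by rewrite mulf_neq0// pnatr_eq0.
apply: (mulfI d2).
move: h; set u := _`_n; set v := _`_n.+1 => h.
transitivity (2 * (n%:R + 1) * (n%:R + 1 + a) * v); first by rewrite -h; ring.
by field.
Qed.


Lemma shifted_jacobi_ode (a b : R) (n : nat) : -1 < a -> -1 < b ->
  ('X ^+ 2 + 2%:P * 'X) * (shifted_jacobi a b n)^`()^`()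
  + ((a + b + 2)%:P * 'X + (2 * (a + 1))%:P) * (shifted_jacobi a b n)^`()
  = (n%:R * (n%:R + a + b + 1))%:P * shifted_jacobi a b n.
Proof.
move=> a1 b1; apply/polyP => k.
have h := @shifted_jacobi_rec a b n k a1 b1.
have -> : ('X ^+ 2 + 2%:P * 'X) * (shifted_jacobi a b n)^`()^`()
  + ((a + b + 2)%:P * 'X + (2 * (a + 1))%:P) * (shifted_jacobi a b n)^`()
  = 'X * ('X * (shifted_jacobi a b n)^`()^`())
    + 2%:P * ('X * (shifted_jacobi a b n)^`()^`())
    + (a + b + 2)%:P * ('X * (shifted_jacobi a b n)^`())
    + (2 * (a + 1))%:P * (shifted_jacobi a b n)^`().
  by ring.
rewrite !coefD !coefCM !coefXM.
case: k h => [|[|k]]/=; rewrite !coef_deriv.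
- rewrite subr0 addr0 => ->; ring.
- have -> : n%:R * (n%:R + a + b + 1) * (shifted_jacobi a b n)`_1
    = (n%:R - 1) * (n%:R + 1 + a + b + 1) * (shifted_jacobi a b n)`_1
      + (a + b + 2) * (shifted_jacobi a b n)`_1 by ring.
  move=> ->; ring.
have -> : n%:R * (n%:R + a + b + 1) * (shifted_jacobi a b n)`_k.+2
  = (n%:R - k.+2%:R) * (n%:R + k.+2%:R + a + b + 1)
      * (shifted_jacobi a b n)`_k.+2
    + k.+2%:R * (k.+2%:R + a + b + 1) * (shifted_jacobi a b n)`_k.+2 by ring.
move=> ->; ring.
Qed.
End shifted_jacobi.

(** * Orthogonality of the explicit solution *)

Section explicit_jacobi.
Context {R : realType}.

Definition explicit_jacobi (a b : R) (n : nat) : {poly R} :=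
  shifted_jacobi a b n \Po ('X - 1%:P).

Lemma size_explicit_jacobi (a b : R) (n : nat) :
  size (explicit_jacobi a b n) = n.+1.
Proof. by rewrite size_comp_poly2 ?size_XsubC// size_shifted_jacobi. Qed.

Lemma explicit_jacobi_monic (a b : R) (n : nat) :
  explicit_jacobi a b n \is monic.
Proof.
rewrite monicE lead_coef_comp ?size_XsubC// lead_coefXsubC expr1n mulr1.
by rewrite lead_coefE size_shifted_jacobi coef_shifted_jacobi_lead.
Qed.

Lemma deriv_comp_shift (p : {poly R}) :
  (p \Po ('X - 1%:P))^`() = p^`() \Po ('X - 1%:P).
Proof. by rewrite deriv_comp derivXsubC mulr1. Qed.

Lemma explicit_jacobi_ode (a b : R) (n : nat) : -1 < a -> -1 < b ->
  (1 - 'X ^+ 2) * (explicit_jacobi a b n)^`()^`()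
  + ((b - a)%:P - (a + b + 2) *: 'X) * (explicit_jacobi a b n)^`()
  = - (n%:R * (n%:R + a + b + 1)) *: explicit_jacobi a b n.
Proof.
move=> a1 b1.
have := congr1 (comp_poly ('X - 1%:P)) (@shifted_jacobi_ode R a b n a1 b1).
rewrite expr2 !(comp_polyD, comp_polyM, comp_polyC, comp_polyX).
rewrite -!deriv_comp_shift -/(explicit_jacobi a b n) -!mul_polyC.
have -> : (b - a)%:P = (a + b + 2)%:P - (2 * (a + 1))%:P.
  by rewrite -polyCB; congr _%:P; ring.
rewrite polyCN polyC_natr polyC1 mulNr => <-; ring.
Qed.

(** Weak form of the eigenvalue equation: the Pearson identity for P' q.  For
    q a second solution the right-hand side is symmetric, hence the
    orthogonality below. *)
Lemma jacobi_int_eigen (a b : R) (n : nat) (q : {poly R}) : -1 < a -> -1 < b ->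
  n%:R * (n%:R + a + b + 1) * jacobi_int a b (explicit_jacobi a b n * q)
  = jacobi_int a b ((1 - 'X ^+ 2) * ((explicit_jacobi a b n)^`() * q^`())).
Proof.
move=> a1 b1; have ode := @explicit_jacobi_ode a b n a1 b1.
apply/esym/eqP; rewrite -subr_eq0 -jacobi_intZ// -jacobi_intB//; apply/eqP.
rewrite -[RHS](@jacobi_pearson R a b ((explicit_jacobi a b n)^`() * q) a1 b1).
congr jacobi_int; rewrite derivM mulrDr [_ * (_ * q)]mulrA.
transitivity ((1 - 'X ^+ 2) * (explicit_jacobi a b n)^`()^`() * q
  + ((b - a)%:P - (a + b + 2) *: 'X) * (explicit_jacobi a b n)^`() * q
  + (1 - 'X ^+ 2) * ((explicit_jacobi a b n)^`() * q^`())); last by ring.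
by rewrite -mulrDl ode -!mul_polyC polyCN; ring.
Qed.

Lemma explicit_jacobi_orthogonal (a b : R) (n m : nat) : -1 < a -> -1 < b ->
  n <> m -> jacobi_int a b (explicit_jacobi a b n * explicit_jacobi a b m) = 0.
Proof.
move=> a1 b1 nm.
pose L := jacobi_int a b (explicit_jacobi a b n * explicit_jacobi a b m).
have eigen : n%:R * (n%:R + a + b + 1) * L = m%:R * (m%:R + a + b + 1) * L.
  apply: (etrans (jacobi_int_eigen a b n (explicit_jacobi a b m) a1 b1)).
  rewrite /L [explicit_jacobi a b n * _]mulrC.
  apply: (etrans _
    (esym (jacobi_int_eigen a b m (explicit_jacobi a b n) a1 b1))).
  by congr jacobi_int; rewrite [X in _ * X]mulrC.
have : (n%:R - m%:R) * (n%:R + m%:R + a + b + 1) * L = 0.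
  transitivity (n%:R * (n%:R + a + b + 1) * L - m%:R * (m%:R + a + b + 1) * L).
    by ring.
  by rewrite eigen subrr.
move/eqP; rewrite !mulf_eq0 subr_eq0 eqr_nat => /orP[/orP[/eqP//|]|/eqP//].
(* The eigenvalues are distinct because a + b + 1 > -1 and n + m >= 1. *)
rewrite gt_eqF//; suff : (1 : R) <= n%:R + m%:R by lra.
by rewrite -natrD ler1n; case: n m nm {eigen L} => [|n] [|m].
Qed.

End explicit_jacobi.

(** * Identification and recurrence of the Jacobi polynomials *)

Section jacobi_characterization.
Context {R : realType}.
Context (a b : R) (a1 : -1 < a) (b1 : -1 < b).
Notation D := (`]-1, 1[%classic : set R).

(** Integrability and nonvanishing of the squares are automatic for the Jacobi
    weights, so that only the vanishing of the mixed integrals matters. *)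
Lemma monic_orthogonal_jacobiP (p : nat -> {poly R}) :
  monic_orthogonal D (jacobi_weight a b) p <->
  (forall n, p n \is monic /\ size (p n) = n.+1) /\
  (forall n m, n <> m -> jacobi_int a b (p n * p m) = 0).
Proof.
have intE n m : \int[@lebesgue_measure R]_(x in D)
    ((p n).[x] * (p m).[x] * jacobi_weight a b x)
    = jacobi_int a b (p n * p m).
  by apply: eq_Rintegral => x _; rewrite hornerM.
split=> -[mp op]; split=> //.
  by move=> n m; have [_ + _] := op n m isT isT; rewrite intE.
move=> n m _ _; rewrite !intE; split.
- apply: eq_integrable (jacobi_weight_integrable a b (p n * p m) a1 b1) => //.
  by move=> x _ /=; rewrite hornerM.
- exact: op.
- move=> -> /(jacobi_int_sqr_eq0 _ _ _ a1 b1) pm0.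
  by have [_] := mp m; rewrite pm0 size_poly0.
Qed.

(** The members of degree < n span the polynomials of degree < n; here this
    is a descent on the size of r, subtracting multiples of p m. *)
Lemma monic_orthogonal_lower (p : nat -> {poly R}) (n : nat) (r : {poly R}) :
  monic_orthogonal D (jacobi_weight a b) p -> (size r <= n)%N ->
  jacobi_int a b (p n * r) = 0.
Proof.
move=> /monic_orthogonal_jacobiP[mp op] rn.
have [m] : exists m, (size r <= m <= n)%N by exists n; rewrite rn leqnn.
elim: m r {rn} => [|m IH] r.
  move=> /andP[]; rewrite leqn0 size_poly_eq0 => /eqP -> _.
  by rewrite mulr0 -(scale0r 0) jacobi_intZ// mul0r.
move=> /andP[rm mn].
have [/monicP pm1 spm] := mp m.
have sr' : (size (r - r`_m *: p m)%R <= m)%N.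
  apply/leq_sizeP => j; rewrite leq_eqVlt coefB coefZ => /predU1P[<-|mj].
    by move: pm1; rewrite lead_coefE spm /= => ->; rewrite mulr1 subrr.
  rewrite [X in X - _]nth_default; last exact: leq_trans rm mj.
  by rewrite [X in _ * X]nth_default ?spm// mulr0 subrr.
rewrite -(subrK (r`_m *: p m) r) mulrDr jacobi_intD//.
rewrite IH ?sr' ?(ltnW mn)// add0r.
rewrite -scalerAr jacobi_intZ// op ?mulr0// => nm.
by rewrite nm ltnn in mn.
Qed.

Lemma monic_orthogonal_uniq (p q : nat -> {poly R}) :
  monic_orthogonal D (jacobi_weight a b) p ->
  monic_orthogonal D (jacobi_weight a b) q -> p = q.
Proof.
move=> op oq; apply/funext => n; apply/eqP; rewrite -subr_eq0; apply/eqP.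
have [/(_ n)[/monicP p1 sp] _] := op; have [/(_ n)[/monicP q1 sq] _] := oq.
have sn : (size (p n - q n)%R <= n)%N.
  apply/leq_sizeP => j; rewrite leq_eqVlt coefB => /predU1P[<-|mj].
    by move: p1 q1; rewrite !lead_coefE sp sq /= => -> ->; rewrite subrr.
  by rewrite !nth_default ?subrr ?sp ?sq.
apply: (jacobi_int_sqr_eq0 _ _ _ a1 b1).
by rewrite {1}mulrBl jacobi_intB// !monic_orthogonal_lower// subrr.
Qed.

Lemma explicit_jacobi_monic_orthogonal :
  monic_orthogonal D (jacobi_weight a b) (explicit_jacobi a b).
Proof.
apply/monic_orthogonal_jacobiP; split=> [n|n m].
  by rewrite explicit_jacobi_monic size_explicit_jacobi.
exact: explicit_jacobi_orthogonal.
Qed.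

Lemma jacobi_explicit : jacobi a b = explicit_jacobi a b.
Proof.
apply: monic_orthogonal_uniq; last exact: explicit_jacobi_monic_orthogonal.
rewrite /jacobi.
exact: (xgetPex _ (ex_intro _ _ explicit_jacobi_monic_orthogonal)).
Qed.

Lemma jacobi_monic_orthogonal :
  monic_orthogonal D (jacobi_weight a b) (jacobi a b).
Proof. by rewrite jacobi_explicit; exact: explicit_jacobi_monic_orthogonal. Qed.

Lemma jacobi_lower (n : nat) (r : {poly R}) : (size r <= n)%N ->
  jacobi_int a b (jacobi a b n * r) = 0.
Proof. exact: monic_orthogonal_lower jacobi_monic_orthogonal. Qed.

(** A polynomial of degree < n orthogonal to all polynomials of degree < n is
    orthogonal to itself.  It is given in the variable t = x - 1, in which the
    top coefficients of the Jacobi polynomials are known. *)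
Lemma comp_shift_eq0 (n : nat) (q : {poly R}) : (size q <= n)%N ->
  (forall r : {poly R}, (size r <= n)%N ->
    jacobi_int a b ((q \Po ('X - 1%:P)) * r) = 0) ->
  q \Po ('X - 1%:P) = 0.
Proof.
move=> sq oq; apply: (jacobi_int_sqr_eq0 a b _ a1 b1); rewrite oq//.
by rewrite size_comp_poly2 ?size_XsubC.
Qed.

(** The difference of the two sides is orthogonal to all polynomials of degree
    < n; the coefficients are the values for which it has degree < n, as its
    coefficients of degree n and n + 1 vanish.  The hypothesis excludes only
    n = 0 with a + b <= -1, where the closed form can degenerate to 0 / 0. *)
Lemma jacobi_recurrence (n : nat) : 0 < 2 * n.+1%:R + a + b - 1 ->
  let m : R := n.+1%:R in
  jacobi a b n.+2
  = ('X - ((b ^+ 2 - a ^+ 2) / ((2 * m + a + b) * (2 * m + a + b + 2)))%:P)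
      * jacobi a b n.+1
    - (4 * m * (m + a) * (m + b) * (m + a + b)
       / ((2 * m + a + b) ^+ 2 * (2 * m + a + b + 1) * (2 * m + a + b - 1)))
      *: jacobi a b n.
Proof.
move=> h0 m; set c := _ / _; set l := _ / _.
pose T := shifted_jacobi a b.
pose q := 'X * T n.+1 + (1 - c)%:P * T n.+1 - l%:P * T n - T n.+2.
have qE : q \Po ('X - 1%:P) =
    ('X - c%:P) * jacobi a b n.+1 - l *: jacobi a b n - jacobi a b n.+2.
  rewrite !jacobi_explicit /q.
  rewrite !(comp_polyB, comp_polyD, comp_polyM, comp_polyC, comp_polyX).
  by rewrite -!/(explicit_jacobi _ _ _) -mul_polyC polyCB polyC1; ring.
apply/esym/eqP; rewrite -subr_eq0 -qE; apply/eqP.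
apply: (@comp_shift_eq0 n).
  apply/leq_sizeP => j nj.
  have sub1 k : (T k.+1)`_k = ('X * T k.+1)`_k.+1 by rewrite coefXM.
  have sub2 k : (T k.+2)`_k = ('X * ('X * T k.+2))`_k.+2 by rewrite !coefXM.
  rewrite !(coefB, coefD, coefCM).
  have [nj3|] := ltnP n.+2 j.
    case: j nj nj3 => // j _ nj3; rewrite coefXM/= /T.
    by rewrite !coef_shifted_jacobi_gt ?mulr0 ?addr0 ?subr0//; lia.
  have n0 : (0 : R) <= n%:R by [].
  rewrite leq_eqVlt => /predU1P[->|].
    rewrite coefXM/= /T !coef_shifted_jacobi_lead !coef_shifted_jacobi_gt//.
    by ring.
  rewrite ltnS leq_eqVlt => /predU1P[->|].
    rewrite (sub1 n.+1) /T !coef_shifted_jacobi_sub1// coef_shifted_jacobi_lead.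
    rewrite coef_shifted_jacobi_gt// /c /m -[n.+2%:R]natr1 -[n.+1%:R]natr1.
    by field; rewrite !gt_eqF//; lra.
  rewrite ltnS => jn; have -> : j = n by apply/eqP; rewrite eqn_leq jn.
  have -> : ('X * T n.+1)`_n = ('X * ('X * T n.+1))`_n.+1.
    by rewrite [RHS]coefXM.
  rewrite (sub1 n) (sub2 n) /T.
  rewrite !coef_shifted_jacobi_sub2// coef_shifted_jacobi_sub1//.
  rewrite coef_shifted_jacobi_lead /l /c /m -[n.+2%:R]natr1.
  move: h0; rewrite -[n.+1%:R]natr1 => h0.
  by field; rewrite !gt_eqF//; lra.
move=> r rn; rewrite qE.
have -> : (('X - c%:P) * jacobi a b n.+1 - l *: jacobi a b n
           - jacobi a b n.+2) * r
  = jacobi a b n.+1 * (('X - c%:P) * r) - l *: (jacobi a b n * r)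
    - jacobi a b n.+2 * r.
  by rewrite -!mul_polyC; ring.
rewrite !jacobi_intB// jacobi_intZ// !jacobi_lower ?mulr0 ?subrr//.
  by rewrite ltnW// ltnW.
rewrite (leq_trans (size_polyMleq _ _))// size_XsubC.
by rewrite ltnS.
Qed.

End jacobi_characterization.

(** The left-hand side is orthogonal to degree < n for the weight (a, b), as
    the factor x - 1 changes the weight to (a+1, b).  The coefficient on the
    right is the difference of the two subleading coefficients in t = x - 1. *)
Lemma jacobi_shift (R : realType) (a b : R) (n : nat) : -1 < a -> -1 < b ->
  ('X - 1%:P) * jacobi (a + 1) b n
  = jacobi a b n.+1
    + (2 * n%:R * (n%:R + a + 1) / (2 * n%:R + a + b + 1)
       - 2 * n.+1%:R * (n.+1%:R + a) / (2 * n.+1%:R + a + b)) *: jacobi a b n.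
Proof.
move=> a1 b1; have a1' : -1 < a + 1 by lra.
set x := _ - _ / _.
pose q := 'X * shifted_jacobi (a + 1) b n - shifted_jacobi a b n.+1
          - x%:P * shifted_jacobi a b n.
have qE : q \Po ('X - 1%:P) =
    ('X - 1%:P) * jacobi (a + 1) b n - (jacobi a b n.+1 + x *: jacobi a b n).
  rewrite !jacobi_explicit// /q.
  rewrite !(comp_polyB, comp_polyM, comp_polyC, comp_polyX).
  by rewrite -!/(explicit_jacobi _ _ _) -mul_polyC polyC1; ring.
apply/eqP; rewrite -subr_eq0 -qE; apply/eqP.
apply: (@comp_shift_eq0 _ a b a1 b1 n).
  apply/leq_sizeP => j nj.
  rewrite !(coefB, coefCM).
  have [nj3|] := ltnP n.+1 j.
    case: j nj nj3 => // j _ nj3; rewrite coefXM/=.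
    by rewrite !coef_shifted_jacobi_gt ?mulr0 ?subrr//; lia.
  rewrite leq_eqVlt => /predU1P[->|].
    rewrite coefXM/= !coef_shifted_jacobi_lead coef_shifted_jacobi_gt//.
    by rewrite mulr0 !subrr.
  rewrite ltnS => jn; have -> : j = n by apply/eqP; rewrite eqn_leq jn.
  have -> : (shifted_jacobi a b n.+1)`_n = ('X * shifted_jacobi a b n.+1)`_n.+1.
    by rewrite coefXM.
  rewrite !coef_shifted_jacobi_sub1// coef_shifted_jacobi_lead mulr1 /x.
  have -> : 2 * n%:R + (a + 1) + b = 2 * n%:R + a + b + 1 by ring.
  by rewrite addrA subrr.
move=> r rn; rewrite qE.
have -> : (('X - 1%:P) * jacobi (a + 1) b n
           - (jacobi a b n.+1 + x *: jacobi a b n)) * r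
  = (-1) *: ((1 - 'X) * (jacobi (a + 1) b n * r))
    - (jacobi a b n.+1 * r + x *: (jacobi a b n * r)).
  move: (jacobi (a + 1) b n) (jacobi a b n.+1) (jacobi a b n) => J1 J2 J3.
  by rewrite -!mul_polyC polyCN polyC1; ring.
rewrite jacobi_intB// jacobi_intD// !jacobi_intZ// -jacobi_int_shift.
by rewrite !jacobi_lower ?mulr0 ?addr0 ?subrr// ltnW.
Qed.

(** * Limits of the recurrence coefficients *)

Section limits.
Context {R : realType}.

Lemma cvg_inv_affine (v : R) : (2 * n%:R + v)^-1 @[n --> \oo] --> (0 : R).
Proof.
apply/gtr0_cvgV0.
  near=> n; have : - v < n%:R by near: n; exact: nbhs_infty_gtr.
  by have : (0 : R) <= n%:R by []; lra.
apply/cvgryPge => A; near=> n.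
have : A - v <= n%:R by near: n; exact: nbhs_infty_ger.
by have : (0 : R) <= n%:R by []; lra.
Unshelve. all: by end_near. Qed.

Lemma cvg_ratio_affine (u v : R) :
  (n%:R + u) / (2 * n%:R + v) @[n --> \oo] --> (1 / 2 : R).
Proof.
have h : (1 / 2 + (u - v / 2) * (2 * n%:R + v)^-1) @[n --> \oo] --> (1 / 2 : R).
  rewrite -[X in _ --> X]addr0; apply: cvgD; first exact: cvg_cst.
  rewrite -[X in _ --> X](mulr0 (u - v / 2)).
  by apply: cvgM; [exact: cvg_cst|exact: cvg_inv_affine].
apply: cvg_trans h; apply: near_eq_cvg; near=> n.
have n0 : 2 * n%:R + v != 0.
  rewrite gt_eqF//; have : - v < n%:R by near: n; exact: nbhs_infty_gtr.
  by have : (0 : R) <= n%:R by []; lra.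
by field.
Unshelve. all: by end_near. Qed.

Lemma cvg_bounded_ex (u : R ^nat) (l : R) : u n @[n --> \oo] --> l ->
  exists M, forall n, `|u n| <= M.
Proof.
move=> ul; have [M [_ MP]] : bounded_fun u.
  by apply: cvg_seq_bounded; apply/cvg_ex; exists l.
by exists (M + 1) => n; apply: MP; rewrite ?ltrDl.
Qed.

(** The coefficient is 4 times a product of four ratios, each tending to 1/2. *)
Lemma lambda_qg_cvg (alpha beta : R) :
  lambda_qg alpha beta n.+1 @[n --> \oo] --> (1 / 4 : R).
Proof.
have -> : (1 / 4 : R) = 4 * ((1 / 2 * (1 / 2)) * (1 / 2 * (1 / 2))) by field.
under eq_cvg => n.
  rewrite (_ : lambda_qg alpha beta n.+1 =
    4 * (((n%:R + -1) / (2 * n%:R + (alpha + beta - 2)))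
          * ((n%:R + alpha) / (2 * n%:R + (alpha + beta - 2)))
       * (((n%:R + (beta - 2)) / (2 * n%:R + (alpha + beta - 1)))
          * ((n%:R + (alpha + beta - 1)) / (2 * n%:R + (alpha + beta - 3)))))).
    over.
  rewrite /lambda_qg /= !addrA expr2 !invfM; ring.
apply: cvgM; first exact: cvg_cst.
by apply: cvgM; apply: cvgM; exact: cvg_ratio_affine.
Qed.

Lemma c_qg_cvg (alpha beta : R) : c_qg alpha beta n.+1 @[n --> \oo] --> (0 : R).
Proof.
rewrite -[X in _ --> X](mulr0 ((beta - alpha - 2) * (beta + alpha))).
under eq_cvg => n.
  rewrite (_ : c_qg alpha beta n.+1 = (beta - alpha - 2) * (beta + alpha) *
     ((2 * n%:R + (alpha + beta - 2))^-1 * (2 * n%:R + (alpha + beta))^-1)).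
    over.
  by rewrite /c_qg /= !addrA !invfM.
apply: cvgM; first exact: cvg_cst.
by rewrite -[X in _ --> X](mulr0 0); apply: cvgM; exact: cvg_inv_affine.
Qed.

End limits.

(** * The quasi-Geronimus polynomials *)

Section quasi_geronimus_theory.
Context {R : realType}.

Lemma chi_difference_equation (alpha beta : R) (n : nat) :
  -1 < alpha -> 0 < beta -> (2 <= n)%N ->
  c_g alpha beta n.+1 - c_g alpha beta n
    + chi alpha beta n - chi alpha beta n.+1
    - lambda_g alpha beta n.+1 / chi alpha beta n
    + lambda_g alpha beta n / chi alpha beta n.-1 = 0.
Proof.
move=> halpha hbeta; case: n => [|[|[|n]]] // _.
  (* For n = 2 the cancelled forms of chi 1 and lambda_g 2 intervene. *)
  rewrite /c_g /lambda_g /chi /=.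
  by field; rewrite !gt_eqF//; lra.
rewrite /c_g /lambda_g /chi /= -[n.+3%:R]natr1 -[n.+2%:R]natr1.
have n0 : (0 : R) <= n%:R by [].
by field; rewrite !gt_eqF//; lra.
Qed.

Lemma quasi_geronimusE (alpha beta : R) (n : nat) :
  -1 < alpha -> 0 < beta -> (1 <= n)%N ->
  quasi_geronimus alpha beta n
  = ('X - 1%:P) * jacobi (alpha + 1) (beta - 1) n.-1.
Proof.
move=> halpha hbeta; case: n => [|n] // _; have b1 : -1 < beta - 1 by lra.
rewrite jacobi_shift// /quasi_geronimus /=; congr (_ + _ *: _).
rewrite /chi; case: n => [|n] /=.
  (* The first term has denominator alpha + beta, possibly 0, but vanishes. *)
  rewrite [2 * 0%:R]mulr0 !mul0r sub0r.
  by field; rewrite !gt_eqF//; lra.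
have n0 : (0 : R) <= n%:R by [].
rewrite -[n.+2%:R]natr1 -[n.+1%:R]natr1.
by field; rewrite !gt_eqF//; lra.
Qed.

Lemma quasi_geronimus_recurrence (alpha beta : R) (n : nat) :
  -1 < alpha -> 0 < beta -> (2 <= n)%N ->
  quasi_geronimus alpha beta n.+1
  = ('X - (c_qg alpha beta n.+1)%:P) * quasi_geronimus alpha beta n
    - lambda_qg alpha beta n.+1 *: quasi_geronimus alpha beta n.-1.
Proof.
move=> halpha hbeta; case: n => [|[|n]] // _; have b1 : -1 < beta - 1 by lra.
have a1 : -1 < alpha + 1 by lra.
have n0 : (0 : R) <= n%:R by [].
rewrite !quasi_geronimusE//= (jacobi_recurrence _ _ a1 b1 n); last first.
  by rewrite -natr1; lra.
rewrite mulrBr -scalerAr mulrCA; congr (_ - _ *: _).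
  congr (('X - _%:P) * _); rewrite /c_qg /= -[n.+2%:R]natr1 -[n.+1%:R]natr1.
  by field; rewrite !gt_eqF//; lra.
rewrite /lambda_qg /= -[n.+2%:R]natr1 -[n.+1%:R]natr1.
by field; rewrite !gt_eqF//; lra.
Qed.

(** Against the weight (alpha-1, beta-1), which may have infinite mass near 1,
    the two factors x - 1 of the product restore the integrable weight
    (alpha+1, beta-1).  Already P^QG_1 = x - 1 belongs to the family. *)
Lemma quasi_geronimus_orthogonal (alpha beta : R) : -1 < alpha -> 0 < beta ->
  orthogonal_from `]-1, 1[%classic (jacobi_weight (alpha - 1) (beta - 1)) 1
    (quasi_geronimus alpha beta).
Proof.
move=> halpha hbeta n m n1 m1; have b1 : -1 < beta - 1 by lra.
have a1 : -1 < alpha + 1 by lra.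
have [_ ort] := jacobi_monic_orthogonal (alpha + 1) (beta - 1) a1 b1.
have prodE (x : R) : x \in (`]-1, 1[%classic : set R) ->
    (quasi_geronimus alpha beta n).[x] * (quasi_geronimus alpha beta m).[x]
      * jacobi_weight (alpha - 1) (beta - 1) x
    = (jacobi (alpha + 1) (beta - 1) n.-1).[x]
      * (jacobi (alpha + 1) (beta - 1) m.-1).[x]
      * jacobi_weight (alpha + 1) (beta - 1) x.
  rewrite inE/= in_itv/= => /andP[x0 x1].
  rewrite !quasi_geronimusE// /jacobi_weight.
  have -> : (1 - x) `^ (alpha + 1) = (1 - x) `^ (alpha - 1) * (1 - x) ^+ 2.
    rewrite -powR_mulrn; last by lra.
    rewrite -powRD; last by apply/implyP => _; lra.
    by congr (_ `^ _); ring.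
  by rewrite !hornerE/=; ring.
have [int_nm eq0 neq0] := ort n.-1 m.-1 isT isT.
split=> [|nm|nm].
- apply: eq_integrable int_nm => //.
  by move=> x xD /=; rewrite prodE.
- apply: (etrans _ (eq0 _)); first exact: eq_Rintegral.
  by move=> nm'; apply: nm; rewrite -(prednK n1) -(prednK m1) nm'.
- apply: contra_not (neq0 (congr1 predn nm)) => <-.
  by apply/esym; exact: eq_Rintegral.
Qed.

End quasi_geronimus_theory.

Theorem mainTheorem6 (R : realType) (alpha beta : R)
    (halpha : -1 < alpha) (hbeta : 0 < beta) :
  (* (i) *)
  (forall n : nat, (2 <= n)%N ->
     c_g alpha beta n.+1 - c_g alpha beta n
       + chi alpha beta n - chi alpha beta n.+1
       - lambda_g alpha beta n.+1 / chi alpha beta n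
       + lambda_g alpha beta n / chi alpha beta n.-1 = 0) /\
  (* (ii) *)
  (forall n : nat, (1 <= n)%N ->
     quasi_geronimus alpha beta n
       = ('X - 1%:P) * jacobi (alpha + 1) (beta - 1) n.-1) /\
  (* (iii) *)
  (forall n : nat, (2 <= n)%N ->
     quasi_geronimus alpha beta n.+1
       = ('X - (c_qg alpha beta n.+1)%:P) * quasi_geronimus alpha beta n
         - lambda_qg alpha beta n.+1 *: quasi_geronimus alpha beta n.-1) /\
  (* (iv) *)
  orthogonal_from `]-1, 1[%classic (jacobi_weight (alpha - 1) (beta - 1)) 2
    (quasi_geronimus alpha beta) /\
  (* (v) *)
  ((exists M : R, forall n : nat, (2 <= n)%N ->
      `|lambda_qg alpha beta n.+1| <= M) /\
   (exists M : R, forall n : nat, (2 <= n)%N ->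
      `|c_qg alpha beta n.+1| <= M) /\
   (lambda_qg alpha beta n.+1 @[n --> \oo] --> (1 / 4 : R)) /\
   (c_qg alpha beta n.+1 @[n --> \oo] --> (0 : R))).
Proof.
have bounded_ex (u : R ^nat) (l : R) : u n @[n --> \oo] --> l ->
    exists M, forall n, (2 <= n)%N -> `|u n| <= M.
  by move=> /cvg_bounded_ex[M uM]; exists M.
split; first by move=> n; exact: chi_difference_equation.
split; first by move=> n; exact: quasi_geronimusE.
split; first by move=> n; exact: quasi_geronimus_recurrence.
split.
  by move=> n m n2 m2; apply: quasi_geronimus_orthogonal => //; exact: ltnW.
split; first exact: bounded_ex (lambda_qg_cvg alpha beta).
split; first exact: bounded_ex (c_qg_cvg alpha beta).
by split; [exact: lambda_qg_cvg|exact: c_qg_cvg].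
Qed.
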